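(* Let $\mathbb{K}$ be a field. The category $\widetilde{\mathcal{S}pec}$ of even algebraic spectral triples over $\mathbb{K}$, with the tensor product and the unit object described in the context, is a monoidal category.
   Context: An even algebraic spectral triple $(\mathcal{A},\mathbb{V},D,\gamma)$ over $\mathbb{K}$ consists of a unital associative $\mathbb{K}$-algebra $\mathcal{A}$, a $\mathbb{K}$-vector space $\mathbb{V}$ with a unital representation $\pi:\mathcal{A}\to\mathcal{E}nd(\mathbb{V})$, a linear operator $D\in\mathcal{E}nd(\mathbb{V})$, and a $\mathbb{Z}_2$-grading operator $\gamma\in\mathcal{E}nd(\mathbb{V})$ (so $\gamma^2=1$) which commutes with every $\pi(a)$ and anticommutes with $D$. Objects of $\widetilde{\mathcal{S}pec}$ are the even algebraic spectral triples. A morphism $(\mathcal{A}_1,\mathbb{V}_1,D_1,\gamma_1)\to(\mathcal{A}_2,\mathbb{V}_2,D_2,\gamma_2)$ is a pair $(\phi,\Phi)$ with $\phi:\mathcal{A}_1\to\mathcal{A}_2$ a unital algebra morphism and $\Phi:\mathbb{V}_1\to\mathbb{V}_2$ a surjective linear map such that $\Phi D_1=D_2\Phi$, $\Phi\gamma_1=\gamma_2\Phi$ and $\Phi\pi_1(x)=\pi_2(\phi(x))\Phi$ for all $x\in\mathcal{A}_1$. Unit object: $(\mathbb{K},\mathbb{K},0,1)$. Tensor product on objects: $(\mathcal{A}_1,\mathbb{V}_1,D_1,\gamma_1)\otimes(\mathcal{A}_2,\mathbb{V}_2,D_2,\gamma_2):=(\mathcal{A}_1\otimes\mathcal{A}_2,\mathbb{V}_1\otimes\mathbb{V}_2,D_1\otimes1+\gamma_1\otimes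 D_2,\gamma_1\otimes\gamma_2)$. Tensor product on morphisms: $(\phi,\Phi)\otimes(\phi',\Phi'):=(\phi\otimes\phi',\Phi\otimes\Phi')$. *)

(* Defs.v *)
From HB Require Import structures.
From mathcomp Require Import all_boot all_algebra.
From mathcomp Require Import boolp.

Set Implicit Arguments.
Unset Strict Implicit.
Unset Printing Implicit Defensive.

Import GRing.Theory.

Local Open Scope ring_scope.
Local Open Scope quotient_scope.

(* The tensor product over a field, as the free abelian group on V * W modulo
   bilinearity: a class of lists [:: (v1, w1); ...; (vn, wn)] stands for the
   sum of the vi (x) wi. The inverse of v (x) w is (- v) (x) w, so it is enough
   to quotient the free abelian monoid. *)
Section Tensor.
Variables (K : fieldType) (V W : lmodType K).

Inductive tensor_rel : seq (V * W) -> seq (V * W) -> Prop :=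
| tensor_rel_refl s : tensor_rel s s
| tensor_rel_sym s t : tensor_rel s t -> tensor_rel t s
| tensor_rel_trans s t u : tensor_rel s t -> tensor_rel t u -> tensor_rel s u
| tensor_rel_cat s s' t t' :
    tensor_rel s s' -> tensor_rel t t' -> tensor_rel (s ++ t) (s' ++ t')
| tensor_rel_catC s t : tensor_rel (s ++ t) (t ++ s)
| tensor_rel_0l w : tensor_rel [:: (0, w)] [::]
| tensor_rel_Dl v v' w : tensor_rel [:: (v + v', w)] [:: (v, w); (v', w)]
| tensor_rel_Dr v w w' : tensor_rel [:: (v, w + w')] [:: (v, w); (v, w')]
| tensor_rel_Z k v w : tensor_rel [:: (k *: v, w)] [:: (v, k *: w)].

Definition tensor_relb : rel (seq (V * W)) := fun s t => `[< tensor_rel s t >].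

Lemma tensor_relb_refl : reflexive tensor_relb.
Proof. by move=> s; apply/asboolP; exact: tensor_rel_refl. Qed.

Lemma tensor_relb_sym : symmetric tensor_relb.
Proof. by move=> s t; apply/asboolP/asboolP; exact: tensor_rel_sym. Qed.

Lemma tensor_relb_trans : transitive tensor_relb.
Proof.
move=> t s u /asboolP st /asboolP tu; apply/asboolP; exact: tensor_rel_trans tu.
Qed.

Canonical tensor_equiv :=
  EquivRel tensor_relb tensor_relb_refl tensor_relb_sym tensor_relb_trans.

Definition tensor : Type := {eq_quot tensor_equiv}.
HB.instance Definition _ := Choice.on tensor.

Definition tensor_sum (s : seq (V * W)) : tensor := \pi_{eq_quot tensor_equiv} s.

Definition pure (v : V) (w : W) : tensor := tensor_sum [:: (v, w)].

Lemma tensor_sumP s t : tensor_rel s t <-> tensor_sum s = tensor_sum t.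
Proof.
split=> [st|]; first by apply/eqmodP/asboolP.
by move=> /eqmodP /asboolP.
Qed.

Definition tensor_repr (x : tensor) : seq (V * W) :=
  repr (x : {eq_quot tensor_equiv}).

Lemma tensor_reprK x : tensor_sum (tensor_repr x) = x.
Proof. exact: reprK. Qed.

Lemma tensor_repr_sum s : tensor_rel (tensor_repr (tensor_sum s)) s.
Proof. by apply/tensor_sumP; rewrite tensor_reprK. Qed.

Definition tensor_scale_seq (k : K) (s : seq (V * W)) : seq (V * W) :=
  [seq (k *: p.1, p.2) | p <- s].

Lemma tensor_scale_seq_rel k s t :
  tensor_rel s t -> tensor_rel (tensor_scale_seq k s) (tensor_scale_seq k t).
Proof.
rewrite /tensor_scale_seq; elim=> {s t}.
- by move=> s; exact: tensor_rel_refl.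
- by move=> s t _; exact: tensor_rel_sym.
- by move=> s t u _ st _; exact: tensor_rel_trans.
- by move=> s s' t t' _ h1 _ h2; rewrite !map_cat; exact: tensor_rel_cat.
- by move=> s t; rewrite !map_cat; exact: tensor_rel_catC.
- by move=> w /=; rewrite scaler0; exact: tensor_rel_0l.
- by move=> v v' w /=; rewrite scalerDr; exact: tensor_rel_Dl.
- by move=> v w w' /=; exact: tensor_rel_Dr.
- move=> l v w /=; rewrite scalerA mulrC -scalerA; exact: tensor_rel_Z.
Qed.

Definition tensor_zero : tensor := tensor_sum [::].
Definition tensor_add (x y : tensor) : tensor :=
  tensor_sum (tensor_repr x ++ tensor_repr y).
Definition tensor_scale (k : K) (x : tensor) : tensor :=
  tensor_sum (tensor_scale_seq k (tensor_repr x)).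
Definition tensor_opp (x : tensor) : tensor := tensor_scale (-1) x.

Lemma tensor_addE s t :
  tensor_add (tensor_sum s) (tensor_sum t) = tensor_sum (s ++ t).
Proof. by apply/tensor_sumP/tensor_rel_cat; exact: tensor_repr_sum. Qed.

Lemma tensor_scaleE k s :
  tensor_scale k (tensor_sum s) = tensor_sum (tensor_scale_seq k s).
Proof. by apply/tensor_sumP/tensor_scale_seq_rel/tensor_repr_sum. Qed.

Lemma tensor_addA : associative tensor_add.
Proof.
move=> x y z; rewrite -(tensor_reprK x) -(tensor_reprK y) -(tensor_reprK z).
by rewrite !tensor_addE catA.
Qed.

Lemma tensor_addC : commutative tensor_add.
Proof. by move=> x y; apply/tensor_sumP/tensor_rel_catC. Qed.

Lemma tensor_add0 : left_id tensor_zero tensor_add.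
Proof.
by move=> x; rewrite -(tensor_reprK x) /tensor_zero tensor_addE.
Qed.

Lemma tensor_scaleDr : right_distributive tensor_scale tensor_add.
Proof.
move=> k x y; rewrite -(tensor_reprK x) -(tensor_reprK y).
by rewrite tensor_addE !tensor_scaleE tensor_addE /tensor_scale_seq map_cat.
Qed.

Lemma tensor_scaleDl x :
  {morph tensor_scale^~ x : k l / k + l >-> tensor_add k l}.
Proof.
move=> k l; rewrite -(tensor_reprK x) !tensor_scaleE tensor_addE.
elim: (tensor_repr x) => [|[v w] s IHs] //=.
rewrite scalerDl -cat1s -[in RHS]cat1s -tensor_addE.
rewrite (_ : tensor_sum [:: _] =
  tensor_sum ([:: (k *: v, w)] ++ [:: (l *: v, w)])); last first.
  by apply/tensor_sumP/tensor_rel_Dl.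
rewrite IHs -!tensor_addE -!tensor_addA -[in RHS](cat1s (l *: v, w)).
by rewrite -!tensor_addE; congr tensor_add; rewrite !tensor_addA;
   congr tensor_add; exact: tensor_addC.
Qed.

Lemma tensor_scale1 : left_id 1 tensor_scale.
Proof.
move=> x; rewrite -(tensor_reprK x) tensor_scaleE; congr tensor_sum.
by rewrite /tensor_scale_seq map_id_in// => -[v w] _ /=; rewrite scale1r.
Qed.

Lemma tensor_scaleA k l x :
  tensor_scale k (tensor_scale l x) = tensor_scale (k * l) x.
Proof.
rewrite -(tensor_reprK x) !tensor_scaleE; congr tensor_sum.
rewrite /tensor_scale_seq -map_comp; apply: eq_map => -[v w] /=.
by rewrite scalerA.
Qed.

Lemma tensor_scale0 x : tensor_scale 0 x = tensor_zero.
Proof.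
rewrite -(tensor_reprK x) tensor_scaleE.
elim: (tensor_repr x) => [|[v w] s IHs] //=.
rewrite scale0r -cat1s -tensor_addE IHs tensor_addC tensor_add0.
by apply/tensor_sumP/tensor_rel_0l.
Qed.

Lemma tensor_addN : left_inverse tensor_zero tensor_opp tensor_add.
Proof.
move=> x; rewrite /tensor_opp -{2}[x]tensor_scale1 -tensor_scaleDl addNr.
exact: tensor_scale0.
Qed.

HB.instance Definition _ := GRing.isZmodule.Build tensor
  tensor_addA tensor_addC tensor_add0 tensor_addN.
HB.instance Definition _ := GRing.Zmodule_isLmodule.Build K tensor
  tensor_scaleA tensor_scale1 tensor_scaleDr tensor_scaleDl.

Lemma tensor_sumE s : tensor_sum s = \sum_(p <- s) pure p.1 p.2.
Proof.
elim: s => [|[v w] s IHs]; first by rewrite big_nil.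
by rewrite big_cons -IHs; symmetry; exact: tensor_addE.
Qed.

Lemma tensor_ind (P : tensor -> Prop) : P 0 ->
  (forall v w, P (pure v w)) -> (forall x y, P x -> P y -> P (x + y)) ->
  forall x, P x.
Proof.
move=> P0 Ppure PD x; rewrite -(tensor_reprK x) tensor_sumE.
by elim/big_ind: _ => // p _.
Qed.

Lemma pure_is_bilinear : bilinear_for
  (GRing.Scale.Law.clone _ _ *:%R _) (GRing.Scale.Law.clone _ _ *:%R _) pure.
Proof.
have pureDl w : {morph pure^~ w : v v' / v + v'}.
  move=> v v'; rewrite [RHS]tensor_addE; apply/tensor_sumP; exact: tensor_rel_Dl.
have pureDr v : {morph pure v : w w' / w + w'}.
  move=> w w'; rewrite [RHS]tensor_addE; apply/tensor_sumP; exact: tensor_rel_Dr.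
have pureZl w k v : pure (k *: v) w = k *: pure v w.
  by symmetry; exact: tensor_scaleE.
split=> [w|v] k u u' /=; first by rewrite pureDl pureZl.
rewrite pureDr -pureZl; congr (_ + _); apply/esym/tensor_sumP.
exact: tensor_rel_Z.
Qed.
HB.instance Definition _ := bilinear_isBilinear.Build K V W tensor _ _ pure
  pure_is_bilinear.

(* The universal property: [tensor_lift f] is the unique linear map sending
   [pure v w] to [f v w], by [tensor_liftE] and [tensor_linear_ext]. *)
Section Lift.
Variables (U : lmodType K) (f : {bilinear V -> W -> U}).

Definition tensor_lift (x : tensor) : U :=
  \sum_(p <- tensor_repr x) f p.1 p.2.

Lemma tensor_lift_rel s t : tensor_rel s t ->
  \sum_(p <- s) f p.1 p.2 = \sum_(p <- t) f p.1 p.2.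
Proof.
elim=> {s t} //.
- by move=> s t u _ -> _ ->.
- by move=> s s' t t' _ st _ st'; rewrite !big_cat/= st st'.
- by move=> s t; rewrite !big_cat/= addrC.
- by move=> w; rewrite big_seq1 big_nil linear0l.
- by move=> v v' w; rewrite !big_cons !big_nil !addr0 linearDl.
- by move=> v w w'; rewrite !big_cons !big_nil !addr0 linearDr.
- by move=> k v w; rewrite !big_seq1 linearZl_LR linearZr_LR.
Qed.

Lemma tensor_liftE v w : tensor_lift (pure v w) = f v w.
Proof.
by rewrite /tensor_lift (tensor_lift_rel (tensor_repr_sum _)) big_seq1.
Qed.

Lemma tensor_lift_is_linear : linear tensor_lift.
Proof.
move=> k x y; rewrite -(tensor_reprK x) -(tensor_reprK y).
have -> : k *: tensor_sum (tensor_repr x) + tensor_sum (tensor_repr y) =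
    tensor_sum (tensor_scale_seq k (tensor_repr x) ++ tensor_repr y).
  by rewrite -tensor_addE -tensor_scaleE.
rewrite /tensor_lift !(tensor_lift_rel (tensor_repr_sum _)) big_cat/=.
congr (_ + _); rewrite big_map scaler_sumr; apply: eq_bigr => p _ /=.
by rewrite linearZl_LR.
Qed.
HB.instance Definition _ :=
  GRing.isLinear.Build K tensor U *:%R tensor_lift tensor_lift_is_linear.

End Lift.

Lemma tensor_linear_ext (U : lmodType K) (f g : {linear tensor -> U}) :
  (forall v w, f (pure v w) = g (pure v w)) -> f =1 g.
Proof.
move=> fg; elim/tensor_ind => [|//|x y xE yE]; first by rewrite !linear0.
by rewrite !linearD /= xE yE.
Qed.

End Tensor.

Section TensorMap.
Variables (K : fieldType).

Section Def.
Variables (V V' W W' : lmodType K).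
Variables (f : {linear V -> V'}) (g : {linear W -> W'}).

Definition pure_map (v : V) (w : W) : tensor V' W' := pure (f v) (g w).

Lemma pure_map_is_bilinear : bilinear_for
  (GRing.Scale.Law.clone _ _ *:%R _) (GRing.Scale.Law.clone _ _ *:%R _) pure_map.
Proof.
by split=> [w|v] k u u' /=; rewrite /pure_map linearP ?linearPl ?linearPr.
Qed.
HB.instance Definition _ :=
  bilinear_isBilinear.Build K V W _ _ _ pure_map pure_map_is_bilinear.

Definition tensor_map : tensor V W -> tensor V' W' := tensor_lift pure_map.
HB.instance Definition _ := GRing.Linear.on tensor_map.

Lemma tensor_mapE v w : tensor_map (pure v w) = pure (f v) (g w).
Proof. exact: tensor_liftE. Qed.

Lemma tensor_map_sum s :
  tensor_map (tensor_sum s) = \sum_(p <- s) pure (f p.1) (g p.2).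
Proof.
by rewrite tensor_sumE linear_sum; apply: eq_bigr => p _; exact: tensor_mapE.
Qed.

Lemma tensor_map_surj : (forall v', exists v, f v = v') ->
  (forall w', exists w, g w = w') -> forall y, exists x, tensor_map x = y.
Proof.
move=> fsurj gsurj; elim/tensor_ind => [|v' w'|y y' [x <-] [x' <-]].
- by exists 0; rewrite linear0.
- have [v <-] := fsurj v'; have [w <-] := gsurj w'.
  by exists (pure v w); exact: tensor_mapE.
- by exists (x + x'); rewrite linearD.
Qed.

End Def.

Section Bilinear.
Variables (A B V W V' W' : lmodType K).
Variables (p : {bilinear A -> V -> V'}) (q : {bilinear B -> W -> W'}).

Section Fixed.
Variable u : tensor V W.

Definition tensor_bil_pure (a : A) (b : B) : tensor V' W' :=
  tensor_map (p a) (q b) u.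

Lemma tensor_bil_pure_is_bilinear : bilinear_for
  (GRing.Scale.Law.clone _ _ *:%R _) (GRing.Scale.Law.clone _ _ *:%R _)
  tensor_bil_pure.
Proof.
split=> [b|a] k x y /=; rewrite /tensor_bil_pure -(tensor_reprK u).
  rewrite !tensor_map_sum scaler_sumr -big_split; apply: eq_bigr => vw _ /=.
  by rewrite !linearPl.
rewrite !tensor_map_sum scaler_sumr -big_split; apply: eq_bigr => vw _ /=.
by rewrite !linearPl linearPr.
Qed.
HB.instance Definition _ :=
  bilinear_isBilinear.Build K A B _ _ _ tensor_bil_pure
    tensor_bil_pure_is_bilinear.
End Fixed.

Definition tensor_bil (x : tensor A B) (u : tensor V W) : tensor V' W' :=
  tensor_lift (tensor_bil_pure u) x.

Lemma tensor_bilE a b u : tensor_bil (pure a b) u = tensor_map (p a) (q b) u.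
Proof. exact: tensor_liftE. Qed.

Lemma tensor_bil_pureE a b v w :
  tensor_bil (pure a b) (pure v w) = pure (p a v) (q b w).
Proof. by rewrite tensor_bilE tensor_mapE. Qed.

Lemma tensor_bil_is_bilinear : bilinear_for
  (GRing.Scale.Law.clone _ _ *:%R _) (GRing.Scale.Law.clone _ _ *:%R _)
  tensor_bil.
Proof.
split=> [u|x] k y z /=; first by rewrite /tensor_bil linearP.
rewrite /tensor_bil /tensor_lift scaler_sumr -big_split; apply: eq_bigr => ab _ /=.
by rewrite /tensor_bil_pure linearP.
Qed.
HB.instance Definition _ :=
  bilinear_isBilinear.Build K (tensor A B) (tensor V W) _ _ _ tensor_bil
    tensor_bil_is_bilinear.
End Bilinear.

End TensorMap.

(* Unital associative algebras, including the zero algebra; an [algType] has to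
   satisfy 1 != 0. *)
Record algebra (K : fieldType) := Algebra {
  alg_space :> lmodType K;
  alg_one : alg_space;
  alg_mul : {bilinear alg_space -> alg_space -> alg_space};
  alg_mulA : associative alg_mul;
  alg_mul1l : left_id alg_one alg_mul;
  alg_mul1r : right_id alg_one alg_mul
}.
Arguments alg_one {K} A : rename.
Arguments alg_mul {K} A : rename.

Section AlgebraOf.
Variables (K : fieldType) (A : algType K).

Definition algType_mul (x y : A) : A := x * y.

Lemma algType_mul_is_bilinear : bilinear_for
  (GRing.Scale.Law.clone _ _ *:%R _) (GRing.Scale.Law.clone _ _ *:%R _)
  algType_mul.
Proof.
split=> [y|x] k u v /=; rewrite /algType_mul ?mulrDl ?mulrDr.
  by rewrite scalerAl.
by rewrite scalerAr.
Qed.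
HB.instance Definition _ := bilinear_isBilinear.Build K A A A _ _ algType_mul
  algType_mul_is_bilinear.

Definition algebra_of : algebra K :=
  @Algebra K A 1 algType_mul (@mulrA A) (@mul1r A) (@mulr1 A).
End AlgebraOf.

Section AlgebraTensor.
Variables (K : fieldType) (A B : algebra K).

Definition tensor_mul : {bilinear tensor A B -> tensor A B -> tensor A B} :=
  tensor_bil (alg_mul A) (alg_mul B).

Lemma tensor_mulE a b a' b' : tensor_mul (pure a b) (pure a' b') =
  pure (alg_mul A a a') (alg_mul B b b').
Proof. exact: tensor_bil_pureE. Qed.

Lemma tensor_mulA : associative tensor_mul.
Proof.
move: tensor_mul tensor_mulE => m mE.
elim/tensor_ind => [||x x' xE x'E] => [y z|a b|y z]; first by rewrite !linear0l.
  elim/tensor_ind => [||y y' yE y'E] => [z|a' b'|z].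
  - by rewrite linear0l !linear0r linear0l.
  - elim/tensor_ind => [||z z' zE z'E] => [|a'' b''|].
    + by rewrite !linear0r.
    + by rewrite !mE !alg_mulA.
    + by rewrite !linearDr zE z'E.
  - by rewrite !(linearDl, linearDr) yE y'E.
by rewrite !linearDl xE x'E.
Qed.

Lemma tensor_mul1l : left_id (pure (alg_one A) (alg_one B)) tensor_mul.
Proof.
move: tensor_mul tensor_mulE => m mE.
elim/tensor_ind => [|a b|x y xE yE]; first by rewrite linear0r.
  by rewrite mE !alg_mul1l.
by rewrite linearDr xE yE.
Qed.

Lemma tensor_mul1r : right_id (pure (alg_one A) (alg_one B)) tensor_mul.
Proof.
move: tensor_mul tensor_mulE => m mE.
elim/tensor_ind => [|a b|x y xE yE]; first by rewrite linear0l.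
  by rewrite mE !alg_mul1r.
by rewrite linearDl xE yE.
Qed.

Definition tensor_alg : algebra K :=
  @Algebra K (tensor A B) (pure (alg_one A) (alg_one B)) tensor_mul
    tensor_mulA tensor_mul1l tensor_mul1r.
End AlgebraTensor.

Record even_spectral_triple (K : fieldType) := EvenSpectralTriple {
  st_alg : algebra K;
  st_space : lmodType K;
  st_rep : {bilinear st_alg -> st_space -> st_space};
  st_dirac : {linear st_space -> st_space};
  st_grading : {linear st_space -> st_space};
  st_rep1 : forall v, st_rep (alg_one st_alg) v = v;
  st_repM : forall a b v,
    st_rep (alg_mul st_alg a b) v = st_rep a (st_rep b v);
  st_gradingK : forall v, st_grading (st_grading v) = v;
  st_grading_rep : forall a v,
    st_grading (st_rep a v) = st_rep a (st_grading v);
  st_grading_dirac : forall v,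
    st_grading (st_dirac v) = - st_dirac (st_grading v)
}.
Arguments st_rep {K} S : rename.
Arguments st_dirac {K} S : rename.
Arguments st_grading {K} S : rename.

Record spec_hom (K : fieldType) (S T : even_spectral_triple K) := SpecHom {
  hom_alg : {linear st_alg S -> st_alg T};
  hom_space : {linear st_space S -> st_space T};
  hom_alg1 : hom_alg (alg_one (st_alg S)) = alg_one (st_alg T);
  hom_algM : forall a b, hom_alg (alg_mul (st_alg S) a b) =
    alg_mul (st_alg T) (hom_alg a) (hom_alg b);
  hom_surj : forall w, exists v, hom_space v = w;
  hom_dirac : forall v, hom_space (st_dirac S v) = st_dirac T (hom_space v);
  hom_grading : forall v,
    hom_space (st_grading S v) = st_grading T (hom_space v);
  hom_rep : forall a v,
    hom_space (st_rep S a v) = st_rep T (hom_alg a) (hom_space v)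
}.

Lemma linear_eq (K : fieldType) (U V : lmodType K) (f g : {linear U -> V}) :
  f =1 g -> f = g.
Proof.
case: f g => f [[f1] [f2]] [g [[g1] [g2]]] /= /funext fg; rewrite -fg in g1 g2 *.
by congr (GRing.Linear.Pack (GRing.Linear.Class _ _)); congr (_ _);
   exact: Prop_irrelevance.
Qed.

Lemma spec_hom_eq (K : fieldType) (S T : even_spectral_triple K)
    (f g : spec_hom S T) :
  hom_alg f =1 hom_alg g -> hom_space f =1 hom_space g -> f = g.
Proof.
case: f g => fa fs f1 f2 f3 f4 f5 f6 [ga gs g1 g2 g3 g4 g5 g6] /=.
move=> /linear_eq ea /linear_eq es; subst ga gs.
by congr SpecHom; exact: Prop_irrelevance.
Qed.

Record category := Category {
  obj :> Type;
  hom : obj -> obj -> Type;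
  idc : forall a, hom a a;
  compc : forall a b c, hom b c -> hom a b -> hom a c;
  compIl : forall a b (f : hom a b), compc (idc b) f = f;
  compIr : forall a b (f : hom a b), compc f (idc a) = f;
  compA : forall a b c d (h : hom c d) (g : hom b c) (f : hom a b),
    compc h (compc g f) = compc (compc h g) f
}.
Arguments idc {C} a : rename.
Arguments compc {C a b c} g f : rename.

Declare Scope category_scope.
Delimit Scope category_scope with cat.
Local Open Scope category_scope.
Notation "g \c f" := (compc g f) (at level 50, left associativity) :
  category_scope.

Definition is_iso (C : category) (a b : C) (f : hom a b) : Prop :=
  exists g : hom b a, g \c f = idc a /\ f \c g = idc b.

Record monoidal_structure (C : category) (T : C -> C -> C)
    (Th : forall a a' b b' : C, hom a a' -> hom b b' -> hom (T a b) (T a' b'))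
    (I : C) := MonoidalStructure {
  tens_id : forall a b, Th a a b b (idc a) (idc b) = idc (T a b);
  tens_comp : forall a a' a'' b b' b'' (g : hom a' a'') (f : hom a a')
      (g' : hom b' b'') (f' : hom b b'),
    Th _ _ _ _ (g \c f) (g' \c f') = Th _ _ _ _ g g' \c Th _ _ _ _ f f';
  assoc : forall a b c, hom (T (T a b) c) (T a (T b c));
  lunit : forall a, hom (T I a) a;
  runit : forall a, hom (T a I) a;
  assoc_iso : forall a b c, is_iso (assoc a b c);
  lunit_iso : forall a, is_iso (lunit a);
  runit_iso : forall a, is_iso (runit a);
  assoc_natural : forall a a' b b' c c'
      (f : hom a a') (g : hom b b') (h : hom c c'),
    assoc a' b' c' \c Th _ _ _ _ (Th _ _ _ _ f g) h =
    Th _ _ _ _ f (Th _ _ _ _ g h) \c assoc a b c;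
  lunit_natural : forall a a' (f : hom a a'),
    lunit a' \c Th _ _ _ _ (idc I) f = f \c lunit a;
  runit_natural : forall a a' (f : hom a a'),
    runit a' \c Th _ _ _ _ f (idc I) = f \c runit a;
  pentagon : forall a b c d,
    assoc a b (T c d) \c assoc (T a b) c d =
    Th _ _ _ _ (idc a) (assoc b c d) \c assoc a (T b c) d \c
      Th _ _ _ _ (assoc a b c) (idc d);
  triangle : forall a b,
    Th _ _ _ _ (idc a) (lunit b) \c assoc a I b =
    Th _ _ _ _ (runit a) (idc b)
}.

Section SpecCategory.
Variable K : fieldType.

Lemma idfun_surj (T : Type) (w : T) : exists v, idfun v = w.
Proof. by exists w. Qed.

Definition spec_id (S : even_spectral_triple K) : spec_hom S S :=
  @SpecHom K S S idfun idfun erefl (fun _ _ => erefl) (@idfun_surj _)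
    (fun _ => erefl) (fun _ => erefl) (fun _ _ => erefl).

Section Comp.
Variables (S T U : even_spectral_triple K) (g : spec_hom T U) (f : spec_hom S T).

Let ga : {linear _ -> _} := hom_alg g \o hom_alg f.
Let gs : {linear _ -> _} := hom_space g \o hom_space f.

Lemma spec_comp_alg1 : ga (alg_one (st_alg S)) = alg_one (st_alg U).
Proof. by rewrite /= !hom_alg1. Qed.

Lemma spec_comp_algM a b : ga (alg_mul (st_alg S) a b) =
  alg_mul (st_alg U) (ga a) (ga b).
Proof. by rewrite /= !hom_algM. Qed.

Lemma spec_comp_surj w : exists v, gs v = w.
Proof.
have [v <-] := hom_surj g w; have [u <-] := hom_surj f v.
by exists u.
Qed.

Lemma spec_comp_dirac v : gs (st_dirac S v) = st_dirac U (gs v).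
Proof. by rewrite /= !hom_dirac. Qed.

Lemma spec_comp_grading v : gs (st_grading S v) = st_grading U (gs v).
Proof. by rewrite /= !hom_grading. Qed.

Lemma spec_comp_rep a v : gs (st_rep S a v) = st_rep U (ga a) (gs v).
Proof. by rewrite /= !hom_rep. Qed.

Definition spec_comp : spec_hom S U :=
  @SpecHom K S U (hom_alg g \o hom_alg f) (hom_space g \o hom_space f)
    spec_comp_alg1 spec_comp_algM spec_comp_surj
    spec_comp_dirac spec_comp_grading spec_comp_rep.
End Comp.

Lemma spec_compIl S T (f : spec_hom S T) : spec_comp (spec_id T) f = f.
Proof. exact: spec_hom_eq. Qed.

Lemma spec_compIr S T (f : spec_hom S T) : spec_comp f (spec_id S) = f.
Proof. exact: spec_hom_eq. Qed.

Lemma spec_compA S T U V (h : spec_hom U V) (g : spec_hom T U)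
    (f : spec_hom S T) :
  spec_comp h (spec_comp g f) = spec_comp (spec_comp h g) f.
Proof. exact: spec_hom_eq. Qed.

Definition Spec : category :=
  @Category (even_spectral_triple K) (@spec_hom K) spec_id spec_comp
    spec_compIl spec_compIr spec_compA.
End SpecCategory.

Section SpecUnit.
Variable K : fieldType.

Lemma spec_unit_dirac (v : K^o) :
  idfun ((\0 : {linear K^o -> K^o}) v) = - (\0 : {linear K^o -> K^o}) (idfun v).
Proof. by rewrite /= oppr0. Qed.

Definition spec_unit : even_spectral_triple K :=
  @EvenSpectralTriple K (algebra_of K^o) K^o (@algType_mul K K^o) \0 idfun
    (@mul1r K) (fun a b v => esym (@mulrA K a b v)) (fun _ => erefl)
    (fun _ _ => erefl) spec_unit_dirac.
End SpecUnit.

Section SpecTensor.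
Variable K : fieldType.

Section Obj.
Variables S T : even_spectral_triple K.

Local Notation A := (tensor (st_alg S) (st_alg T)).
Local Notation V := (tensor (st_space S) (st_space T)).

Definition tensor_rep : {bilinear A -> V -> V} :=
  tensor_bil (st_rep S) (st_rep T).

Definition tensor_dirac : {linear V -> V} :=
  tensor_map (st_dirac S) idfun \+ tensor_map (st_grading S) (st_dirac T).

Definition tensor_grading : {linear V -> V} :=
  tensor_map (st_grading S) (st_grading T).

Lemma tensor_repE a b v w :
  tensor_rep (pure a b) (pure v w) = pure (st_rep S a v) (st_rep T b w).
Proof. exact: tensor_bil_pureE. Qed.

Lemma tensor_diracE v w : tensor_dirac (pure v w) =
  pure (st_dirac S v) w + pure (st_grading S v) (st_dirac T w).
Proof. by rewrite /= !tensor_mapE. Qed.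

Lemma tensor_gradingE v w :
  tensor_grading (pure v w) = pure (st_grading S v) (st_grading T w).
Proof. exact: tensor_mapE. Qed.

Lemma tensor_rep1 v :
  tensor_rep (pure (alg_one (st_alg S)) (alg_one (st_alg T))) v = v.
Proof.
move: tensor_rep tensor_repE v => r rE.
elim/tensor_ind => [|v w|x y xE yE]; first exact: linear0r.
  by rewrite rE !st_rep1.
by rewrite linearDr xE yE.
Qed.

Lemma tensor_repM a b v :
  tensor_rep (tensor_mul (st_alg S) (st_alg T) a b) v =
  tensor_rep a (tensor_rep b v).
Proof.
move: (tensor_mulE (A := st_alg S) (B := st_alg T)) a b v.
move: (tensor_mul _ _) => m mE.
move: tensor_rep tensor_repE => r rE.
elim/tensor_ind => [||x x' xE x'E] => [y z|a b|y z]; first by rewrite !linear0l.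
  elim/tensor_ind => [||y y' yE y'E] => [z|a' b'|z].
  - by rewrite linear0l !linear0r linear0l.
  - elim/tensor_ind => [||z z' zE z'E] => [|v w|].
    + by rewrite !linear0r.
    + by rewrite !(mE, rE) !st_repM.
    + by rewrite !linearDr zE z'E.
  - by rewrite !(linearDl, linearDr) yE y'E.
by rewrite !linearDl xE x'E.
Qed.

Lemma tensor_gradingK v : tensor_grading (tensor_grading v) = v.
Proof.
move: tensor_grading tensor_gradingE v => g gE.
elim/tensor_ind => [|v w|x y xE yE]; first by rewrite !linear0.
  by rewrite !gE !st_gradingK.
by rewrite !linearD /= xE yE.
Qed.

Lemma tensor_grading_rep a v :
  tensor_grading (tensor_rep a v) = tensor_rep a (tensor_grading v).
Proof.
move: tensor_grading tensor_gradingE tensor_rep tensor_repE a v => g gE r rE.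
elim/tensor_ind => [|a b|x y xE yE] u; first by rewrite !(linear0, linear0l).
  elim/tensor_ind: u => [|v w|x y xE yE].
  - by rewrite !(linear0r, linear0).
  - by rewrite !(gE, rE) !st_grading_rep.
  - by rewrite !(linearD, linearDr) /= xE yE.
by rewrite !linearDl linearD /= xE yE.
Qed.

Lemma tensor_grading_dirac v :
  tensor_grading (tensor_dirac v) = - tensor_dirac (tensor_grading v).
Proof.
move: tensor_grading tensor_gradingE tensor_dirac tensor_diracE v => g gE d dE.
elim/tensor_ind => [|v w|x y xE yE]; first by rewrite !linear0.
  rewrite gE !dE linearD /= !gE !st_grading_dirac opprD.
  by rewrite linearNl linearNr.
by rewrite !linearD /= xE yE.
Qed.

Definition spec_tensor : even_spectral_triple K :=
  @EvenSpectralTriple K (tensor_alg (st_alg S) (st_alg T)) V tensor_rep tensor_dirac tensor_grading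
    tensor_rep1 tensor_repM tensor_gradingK tensor_grading_rep
    tensor_grading_dirac.
End Obj.

Section Hom.
Variables (S S' T T' : even_spectral_triple K).
Variables (f : spec_hom S S') (g : spec_hom T T').

Local Notation A := (tensor (st_alg S) (st_alg T)).
Local Notation A' := (tensor (st_alg S') (st_alg T')).
Local Notation V := (tensor (st_space S) (st_space T)).
Local Notation V' := (tensor (st_space S') (st_space T')).

Definition tensor_hom_alg : {linear A -> A'} :=
  tensor_map (hom_alg f) (hom_alg g).

Definition tensor_hom_space : {linear V -> V'} :=
  tensor_map (hom_space f) (hom_space g).

Lemma tensor_hom_algE a b :
  tensor_hom_alg (pure a b) = pure (hom_alg f a) (hom_alg g b).
Proof. exact: tensor_mapE. Qed.

Lemma tensor_hom_spaceE v w :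
  tensor_hom_space (pure v w) = pure (hom_space f v) (hom_space g w).
Proof. exact: tensor_mapE. Qed.

Lemma tensor_hom_alg1 :
  tensor_hom_alg (pure (alg_one (st_alg S)) (alg_one (st_alg T))) =
  pure (alg_one (st_alg S')) (alg_one (st_alg T')).
Proof. by rewrite tensor_hom_algE !hom_alg1. Qed.

Lemma tensor_hom_algM a b : 
  tensor_hom_alg (tensor_mul (st_alg S) (st_alg T) a b) =
  tensor_mul (st_alg S') (st_alg T') (tensor_hom_alg a) (tensor_hom_alg b).
Proof.
move: (tensor_mulE (A := st_alg S) (B := st_alg T)).
move: (tensor_mulE (A := st_alg S') (B := st_alg T')).
move: tensor_hom_alg tensor_hom_algE a b.
move: (tensor_mul _ _) => m'; move: (tensor_mul _ _) => m.
move=> h hE + + m'E mE.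
elim/tensor_ind => [|a b|x y xE yE] u; first by rewrite !(linear0, linear0l).
  elim/tensor_ind: u => [|v w|x y xE yE].
  - by rewrite !(linear0r, linear0).
  - by rewrite !(mE, m'E, hE) !hom_algM.
  - by rewrite !(linearD, linearDr) /= xE yE.
by rewrite !(linearDl, linearD) /= xE yE ?linearDl.
Qed.

Lemma tensor_hom_surj w : exists v, tensor_hom_space v = w.
Proof. by apply: tensor_map_surj; exact: hom_surj. Qed.

Lemma tensor_hom_dirac v :
  tensor_hom_space (tensor_dirac S T v) =
  tensor_dirac S' T' (tensor_hom_space v).
Proof.
move: (tensor_dirac S T) (@tensor_diracE S T) => d dE.
move: (tensor_dirac S' T') (@tensor_diracE S' T') => d' d'E.
move: tensor_hom_space tensor_hom_spaceE v => h hE.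
elim/tensor_ind => [|v w|x y xE yE]; first by rewrite !linear0.
  by rewrite hE dE d'E linearD /= !hE !hom_dirac !hom_grading.
by rewrite !linearD /= xE yE.
Qed.

Lemma tensor_hom_grading v :
  tensor_hom_space (tensor_grading S T v) =
  tensor_grading S' T' (tensor_hom_space v).
Proof.
move: (tensor_grading S T) (@tensor_gradingE S T) => d dE.
move: (tensor_grading S' T') (@tensor_gradingE S' T') => d' d'E.
move: tensor_hom_space tensor_hom_spaceE v => h hE.
elim/tensor_ind => [|v w|x y xE yE]; first by rewrite !linear0.
  by rewrite hE dE d'E /= !hE !hom_grading.
by rewrite !linearD /= xE yE.
Qed.

Lemma tensor_hom_rep a v :
  tensor_hom_space (tensor_rep S T a v) =
  tensor_rep S' T' (tensor_hom_alg a) (tensor_hom_space v).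
Proof.
move: (tensor_rep S T) (@tensor_repE S T) => r rE.
move: (tensor_rep S' T') (@tensor_repE S' T') => r' r'E.
move: tensor_hom_space tensor_hom_spaceE v => h hE.
move: tensor_hom_alg tensor_hom_algE a => k kE.
elim/tensor_ind => [|a b|x y xE yE] u; first by rewrite !(linear0, linear0l).
  elim/tensor_ind: u => [|v w|x y xE yE].
  - by rewrite !(linear0r, linear0).
  - by rewrite !(rE, r'E, hE, kE) !hom_rep.
  - by rewrite !(linearD, linearDr) /= xE yE.
by rewrite !linearDl !linearD /= xE yE linearDl.
Qed.

Definition spec_tensor_hom : spec_hom (spec_tensor S T) (spec_tensor S' T') :=
  @SpecHom K (spec_tensor S T) (spec_tensor S' T')
    tensor_hom_alg tensor_hom_space tensor_hom_alg1 tensor_hom_algM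
    tensor_hom_surj tensor_hom_dirac tensor_hom_grading tensor_hom_rep.
End Hom.
End SpecTensor.

(* Main.v *)
(* The associator and the unitors are those of vector spaces: the maps
   (u (x) v) (x) w |-> u (x) (v (x) w), k (x) v |-> k v and v (x) k |-> k v,
   taken both on the algebras and on the representation spaces. Products and
   representations on tensor products are instances of one construction
   [tensor_bil], so a single compatibility of each map with [tensor_bil] gives
   multiplicativity as well as equivariance. The associator intertwines the
   Dirac operators because both bracketings give
   D (x) 1 (x) 1 + g (x) D (x) 1 + g (x) g (x) D; for the unitors the Dirac
   operator of the unit object is 0 and its grading is 1. Coherence is checked
   on pure tensors. *)
From HB Require Import structures.
Require Import Defs.
From mathcomp Require Import all_boot all_algebra.

Set Implicit Arguments.
Unset Strict Implicit.
Unset Printing Implicit Defensive.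

Import GRing.Theory.
Local Open Scope ring_scope.

(* The library's instance for partial applications of a bilinear map is keyed on
   the coercion [Bilinear.sort], hence does not apply to [pure u]. *)
HB.instance Definition _ (K : fieldType) (U V : lmodType K) (u : U) :=
  GRing.isLinear.Build K V (tensor U V) *:%R (pure u)
    (fun k => linearPr (@pure K U V) u k).

(** * Induction on pure tensors of three and four factors *)

Section TensorInduction.
Variable K : fieldType.

(** Additivity of [pure] in its first argument reduces [pure x w] to the case of a pure [x].
    Identities between linear maps on iterated products then only need checking on pure tensors. *)
Lemma tensor_ind3 (U V W : lmodType K) (P : tensor (tensor U V) W -> Prop) :
  P 0 -> (forall u v w, P (pure (pure u v) w)) ->
  (forall x y, P x -> P y -> P (x + y)) -> forall x, P x.
Proof.
move=> P0 Ppure PD; elim/tensor_ind => // x w.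
elim/tensor_ind: x => [|//|x y Px Py]; first by rewrite linear0l.
by rewrite linearDl; exact: PD.
Qed.

Lemma tensor_ind3r (U V W : lmodType K) (P : tensor U (tensor V W) -> Prop) :
  P 0 -> (forall u v w, P (pure u (pure v w))) ->
  (forall x y, P x -> P y -> P (x + y)) -> forall x, P x.
Proof.
move=> P0 Ppure PD; elim/tensor_ind => // u x.
elim/tensor_ind: x => [|//|x y Px Py]; first by rewrite linear0r.
by rewrite linearDr; exact: PD.
Qed.

Lemma tensor_ind4 (U V W X : lmodType K)
    (P : tensor (tensor (tensor U V) W) X -> Prop) :
  P 0 -> (forall u v w x, P (pure (pure (pure u v) w) x)) ->
  (forall x y, P x -> P y -> P (x + y)) -> forall x, P x.
Proof.
move=> P0 Ppure PD; elim/tensor_ind => // y x.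
elim/tensor_ind3: y => [|//|y z Py Pz]; first by rewrite linear0l.
by rewrite linearDl; exact: PD.
Qed.

End TensorInduction.

(** * The associator of vector spaces and its inverse *)

Section Associator.
Variables (K : fieldType) (U V W : lmodType K).

(** With [w] fixed this is linear in [x] by construction, which leaves only linearity in [w] to an
    induction on [x]. *)
Definition assoc_pure (x : tensor U V) (w : W) : tensor U (tensor V W) :=
  tensor_map idfun (applyr (@pure K V W) w) x.

Lemma assoc_pureE u v w : assoc_pure (pure u v) w = pure u (pure v w).
Proof. exact: tensor_mapE. Qed.

Lemma assoc_pure_is_bilinear : bilinear_for
  (GRing.Scale.Law.clone _ _ *:%R _) (GRing.Scale.Law.clone _ _ *:%R _)
  assoc_pure.
Proof.
split=> [w|x] k y z /=; first by rewrite /assoc_pure linearP.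
elim/tensor_ind: x => [|u v|x x' xE x'E].
- by rewrite /assoc_pure !linear0 addr0.
- by rewrite !assoc_pureE !linearPr.
- move: xE x'E; rewrite /assoc_pure !linearD /= => -> ->.
  by rewrite addrACA.
Qed.
HB.instance Definition _ := bilinear_isBilinear.Build K (tensor U V) W _ _ _
  assoc_pure assoc_pure_is_bilinear.

Definition tensor_assoc : tensor (tensor U V) W -> tensor U (tensor V W) :=
  tensor_lift assoc_pure.
HB.instance Definition _ := GRing.Linear.on tensor_assoc.

Lemma tensor_assocE u v w :
  tensor_assoc (pure (pure u v) w) = pure u (pure v w).
Proof. by rewrite [LHS]tensor_liftE; exact: assoc_pureE. Qed.

(** The mirror image of [assoc_pure]: linearity in [y] is built in, and linearity in [u] needs the
    induction. *)
Definition assoc_inv_pure (u : U) (y : tensor V W) : tensor (tensor U V) W :=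
  tensor_map (pure u) idfun y.

Lemma assoc_inv_pureE u v w : assoc_inv_pure u (pure v w) = pure (pure u v) w.
Proof. exact: tensor_mapE. Qed.

Lemma assoc_inv_pure_is_bilinear : bilinear_for
  (GRing.Scale.Law.clone _ _ *:%R _) (GRing.Scale.Law.clone _ _ *:%R _)
  assoc_inv_pure.
Proof.
split=> [x|u] k y z /=; last by rewrite /assoc_inv_pure linearP.
elim/tensor_ind: x => [|v w|x x' xE x'E].
- by rewrite /assoc_inv_pure !linear0 addr0.
- by rewrite !assoc_inv_pureE !linearPl.
- move: xE x'E; rewrite /assoc_inv_pure !linearD /= => -> ->.
  by rewrite addrACA.
Qed.
HB.instance Definition _ := bilinear_isBilinear.Build K U (tensor V W) _ _ _
  assoc_inv_pure assoc_inv_pure_is_bilinear.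

Definition tensor_assoc_inv :
    tensor U (tensor V W) -> tensor (tensor U V) W :=
  tensor_lift assoc_inv_pure.
HB.instance Definition _ := GRing.Linear.on tensor_assoc_inv.

Lemma tensor_assoc_invE u v w :
  tensor_assoc_inv (pure u (pure v w)) = pure (pure u v) w.
Proof. by rewrite [LHS]tensor_liftE; exact: assoc_inv_pureE. Qed.

Lemma tensor_assocK : cancel tensor_assoc tensor_assoc_inv.
Proof.
elim/tensor_ind3 => [|u v w|x y xE yE]; first by rewrite !linear0.
  by rewrite tensor_assocE tensor_assoc_invE.
by rewrite !linearD /= xE yE.
Qed.

Lemma tensor_assoc_invK : cancel tensor_assoc_inv tensor_assoc.
Proof.
elim/tensor_ind3r => [|u v w|x y xE yE]; first by rewrite !linear0.
  by rewrite tensor_assoc_invE tensor_assocE.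
by rewrite !linearD /= xE yE.
Qed.

End Associator.

(** * Naturality, compatibility with bilinear maps, and the pentagon *)

Section AssociatorTheory.
Variable K : fieldType.

Lemma tensor_assoc_natural (U U' V V' W W' : lmodType K) (f : {linear U -> U'})
    (g : {linear V -> V'}) (h : {linear W -> W'}) x :
  tensor_assoc (tensor_map (tensor_map f g) h x) =
  tensor_map f (tensor_map g h) (tensor_assoc x).
Proof.
elim/tensor_ind3: x => [|u v w|x y xE yE]; first by rewrite !linear0.
  by rewrite tensor_assocE !tensor_mapE /= !tensor_mapE tensor_assocE.
by rewrite !linearD /= xE yE.
Qed.

(** Both sides are additive in [a] and in [x], and on pure tensors both equal
    [pure (p a u) (pure (q b v) (r c w))]. *)
Lemma tensor_assoc_bil (A B C U V W U' V' W' : lmodType K)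
    (p : {bilinear A -> U -> U'}) (q : {bilinear B -> V -> V'})
    (r : {bilinear C -> W -> W'}) a x :
  tensor_assoc (tensor_bil (tensor_bil p q) r a x) =
  tensor_bil p (tensor_bil q r) (tensor_assoc a) (tensor_assoc x).
Proof.
elim/tensor_ind3: a => [|a b c|a a' aE a'E]; first by rewrite !(linear0l, linear0).
  elim/tensor_ind3: x => [|u v w|x y xE yE]; first by rewrite !(linear0r, linear0).
    by rewrite !tensor_assocE !tensor_bil_pureE /= !tensor_bil_pureE tensor_assocE.
  by rewrite !(linearDr, linearD) /= xE yE.
by rewrite !(linearDl, linearD) /= aE a'E.
Qed.

Lemma tensor_pentagon (U V W X : lmodType K) x :
  tensor_assoc (tensor_assoc x) =
  tensor_map idfun (@tensor_assoc K V W X) (tensor_assoc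
    (tensor_map (@tensor_assoc K U V W) idfun x)).
Proof.
elim/tensor_ind4: x => [|u v w x|x y xE yE]; first by rewrite !linear0.
  by rewrite tensor_mapE /= !tensor_assocE tensor_mapE /= tensor_assocE.
by rewrite !linearD /= xE yE.
Qed.

End AssociatorTheory.

(** * The unitors of vector spaces and their inverses *)

Section Unitors.
Variables (K : fieldType) (V : lmodType K).

Definition scale_l (k : K^o) (v : V) : V := k *: v.
Definition scale_r (v : V) (k : K^o) : V := k *: v.

Lemma scale_l_is_bilinear : bilinear_for
  (GRing.Scale.Law.clone _ _ *:%R _) (GRing.Scale.Law.clone _ _ *:%R _) scale_l.
Proof.
split=> [v|l] k x y; rewrite /= /scale_l; first by rewrite scalerDl scalerA.
by rewrite scalerDr !scalerA mulrC.
Qed.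
HB.instance Definition _ :=
  bilinear_isBilinear.Build K K^o V _ _ _ scale_l scale_l_is_bilinear.

Lemma scale_r_is_bilinear : bilinear_for
  (GRing.Scale.Law.clone _ _ *:%R _) (GRing.Scale.Law.clone _ _ *:%R _) scale_r.
Proof.
split=> [l|v] k x y; rewrite /= /scale_r; last by rewrite scalerDl scalerA.
by rewrite scalerDr !scalerA mulrC.
Qed.
HB.instance Definition _ :=
  bilinear_isBilinear.Build K V K^o _ _ _ scale_r scale_r_is_bilinear.

Definition tensor_lunit : tensor K^o V -> V := tensor_lift scale_l.
HB.instance Definition _ := GRing.Linear.on tensor_lunit.
Definition tensor_runit : tensor V K^o -> V := tensor_lift scale_r.
HB.instance Definition _ := GRing.Linear.on tensor_runit.

Lemma tensor_lunitE k v : tensor_lunit (pure k v) = k *: v.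
Proof. exact: tensor_liftE. Qed.

Lemma tensor_runitE v k : tensor_runit (pure v k) = k *: v.
Proof. exact: tensor_liftE. Qed.

Definition tensor_lunit_inv : V -> tensor K^o V := pure (1 : K^o).
HB.instance Definition _ := GRing.Linear.on tensor_lunit_inv.
Definition tensor_runit_inv : V -> tensor V K^o :=
  applyr (@pure K V K^o) (1 : K^o).
HB.instance Definition _ := GRing.Linear.on tensor_runit_inv.

Lemma tensor_lunitK : cancel tensor_lunit tensor_lunit_inv.
Proof.
elim/tensor_ind => [|k v|x y xE yE]; first by rewrite !linear0.
  (* The scalar moves from [v] onto the factor [1]; in [K^o] scaling is multiplication, so [k *: 1]
     is [k * 1]. *)
  by rewrite tensor_lunitE /tensor_lunit_inv linearZ -linearZl_LR /= [k *: _]mulr1.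
by rewrite !linearD /= xE yE.
Qed.

Lemma tensor_lunit_invK : cancel tensor_lunit_inv tensor_lunit.
Proof. by move=> v; rewrite tensor_lunitE scale1r. Qed.

Lemma tensor_runitK : cancel tensor_runit tensor_runit_inv.
Proof.
elim/tensor_ind => [|v k|x y xE yE]; first by rewrite !linear0.
  by rewrite tensor_runitE /tensor_runit_inv linearZ -linearZr_LR /= [k *: _]mulr1.
by rewrite !linearD /= xE yE.
Qed.

Lemma tensor_runit_invK : cancel tensor_runit_inv tensor_runit.
Proof. by move=> v; rewrite tensor_runitE scale1r. Qed.

End Unitors.

(** * Properties of the unitors, the triangle, and functoriality of the tensor product *)

Section TensorCoherence.
Variable K : fieldType.

Lemma tensor_lunit_natural (V V' : lmodType K) (f : {linear V -> V'}) x :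
  tensor_lunit (tensor_map idfun f x) = f (tensor_lunit x).
Proof.
elim/tensor_ind: x => [|k v|x y xE yE]; first by rewrite !linear0.
  by rewrite tensor_mapE !tensor_lunitE linearZ.
by rewrite !linearD /= xE yE.
Qed.

Lemma tensor_runit_natural (V V' : lmodType K) (f : {linear V -> V'}) x :
  tensor_runit (tensor_map f idfun x) = f (tensor_runit x).
Proof.
elim/tensor_ind: x => [|v k|x y xE yE]; first by rewrite !linear0.
  by rewrite tensor_mapE !tensor_runitE linearZ.
by rewrite !linearD /= xE yE.
Qed.

(** Scalars come out of both arguments of [p]: on pure tensors both sides are [(k * l) *: p a v]. *)
Lemma tensor_lunit_bil (A V V' : lmodType K) (p : {bilinear A -> V -> V'}) a x :
  tensor_lunit (tensor_bil (@algType_mul K K^o) p a x) =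
  p (tensor_lunit a) (tensor_lunit x).
Proof.
elim/tensor_ind: a => [|k a|a a' aE a'E]; first by rewrite !(linear0l, linear0).
  elim/tensor_ind: x => [|l v|x y xE yE]; first by rewrite !(linear0r, linear0).
    rewrite tensor_bil_pureE !tensor_lunitE linearZl_LR linearZr_LR.
    by rewrite scalerA.
  by rewrite !(linearDr, linearD) /= xE yE.
by rewrite !(linearD, linearDl) /= aE a'E.
Qed.

Lemma tensor_runit_bil (A V V' : lmodType K) (p : {bilinear A -> V -> V'}) a x :
  tensor_runit (tensor_bil p (@algType_mul K K^o) a x) =
  p (tensor_runit a) (tensor_runit x).
Proof.
elim/tensor_ind: a => [|a k|a a' aE a'E]; first by rewrite !(linear0l, linear0).
  elim/tensor_ind: x => [|v l|x y xE yE]; first by rewrite !(linear0r, linear0).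
    rewrite tensor_bil_pureE !tensor_runitE linearZl_LR linearZr_LR.
    by rewrite scalerA.
  by rewrite !(linearDr, linearD) /= xE yE.
by rewrite !(linearD, linearDl) /= aE a'E.
Qed.

(** The middle scalar acts on [v] on one side and on [u] on the other, and these agree because
    scalars pass across the tensor sign. *)
Lemma tensor_triangle (U V : lmodType K) x :
  tensor_map idfun (@tensor_lunit K V) (tensor_assoc x) =
  tensor_map (@tensor_runit K U) idfun x.
Proof.
elim/tensor_ind3: x => [|u k v|x y xE yE]; first by rewrite !linear0.
  rewrite tensor_assocE !tensor_mapE /= tensor_lunitE tensor_runitE.
  by rewrite linearZl_LR linearZr_LR.
by rewrite !linearD /= xE yE.
Qed.

Lemma tensor_map_id (U V : lmodType K) (x : tensor U V) :
  tensor_map idfun idfun x = x.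
Proof.
elim/tensor_ind: x => [|u v|x y xE yE]; first by rewrite linear0.
  by rewrite tensor_mapE.
by rewrite linearD /= xE yE.
Qed.

Lemma tensor_map_comp (U U' U'' V V' V'' : lmodType K)
    (f : {linear U -> U'}) (f' : {linear U' -> U''})
    (g : {linear V -> V'}) (g' : {linear V' -> V''}) x :
  tensor_map (f' \o f) (g' \o g) x = tensor_map f' g' (tensor_map f g x).
Proof.
elim/tensor_ind: x => [|u v|x y xE yE]; first by rewrite !linear0.
  by rewrite !tensor_mapE.
by rewrite !linearD /= xE yE.
Qed.

End TensorCoherence.

(** * Lifting the structure maps to spectral triples *)

Section SpecMonoidal.
Variable K : fieldType.

Section Iso.
Variables (S T : even_spectral_triple K) (f : spec_hom S T).
Variables (ga : {linear st_alg T -> st_alg S}).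
Variables (gs : {linear st_space T -> st_space S}).
Hypotheses (faK : cancel (hom_alg f) ga) (gaK : cancel ga (hom_alg f)).
Hypotheses (fsK : cancel (hom_space f) gs) (gsK : cancel gs (hom_space f)).

(** Inverse linear maps inherit every compatibility condition: write the arguments as images under
    [f], use the condition for [f], and cancel. Surjectivity of [gs] follows from [fsK]. Inverses of
    the structure maps thus need no separate verification. *)
Lemma spec_iso : @is_iso (Spec K) S T f.
Proof.
have g1 : ga (alg_one (st_alg T)) = alg_one (st_alg S).
  by rewrite -(hom_alg1 f) faK.
have gM a b : ga (alg_mul (st_alg T) a b) = alg_mul (st_alg S) (ga a) (ga b).
  by rewrite -{1}(gaK a) -{1}(gaK b) -hom_algM faK.
have gsurj w : exists v, gs v = w by exists (hom_space f w).
have gD v : gs (st_dirac T v) = st_dirac S (gs v).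
  by rewrite -{1}(gsK v) -hom_dirac fsK.
have gG v : gs (st_grading T v) = st_grading S (gs v).
  by rewrite -{1}(gsK v) -hom_grading fsK.
have gR a v : gs (st_rep T a v) = st_rep S (ga a) (gs v).
  by rewrite -{1}(gaK a) -{1}(gsK v) -hom_rep fsK.
exists (SpecHom g1 gM gsurj gD gG gR).
by split; apply: spec_hom_eq.
Qed.
End Iso.

Section Associator.
Variables R S T : even_spectral_triple K.

Let fa : {linear _ -> _} := @tensor_assoc K (st_alg R) (st_alg S) (st_alg T).
Let fs : {linear _ -> _} := @tensor_assoc K (st_space R) (st_space S) (st_space T).

Lemma spec_assoc_surj w : exists v, fs v = w.
Proof. by exists (tensor_assoc_inv w); exact: tensor_assoc_invK. Qed.

Lemma spec_assoc_dirac v :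
  fs (st_dirac (spec_tensor (spec_tensor R S) T) v) =
  st_dirac (spec_tensor R (spec_tensor S T)) (fs v).
Proof.
elim/tensor_ind3: v => [|u v w|x y xE yE]; first by rewrite !linear0.
  rewrite /= tensor_assocE !tensor_mapE /= !tensor_mapE.
  (* The left side brackets the three terms as [(a + b) + c], the right side as [a + (b + c)]. *)
  rewrite linearDl linearDr !linearD /= !tensor_assocE.
  by rewrite addrA.
(* Each Dirac operator is split over [x + y] as a single linear map, without expanding its defining
   sum. *)
rewrite (linearD (st_dirac (spec_tensor (spec_tensor R S) T))) [LHS]linearD xE yE.
by rewrite (linearD fs) [RHS](linearD (st_dirac (spec_tensor R (spec_tensor S T)))).
Qed.

(** The grading of a triple product is the tensor product of the three gradings, so this is
    naturality of the associator. *)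
Lemma spec_assoc_grading v :
  fs (st_grading (spec_tensor (spec_tensor R S) T) v) =
  st_grading (spec_tensor R (spec_tensor S T)) (fs v).
Proof. exact: tensor_assoc_natural. Qed.

(** The unit of the triple product is a pure tensor, hence [tensor_assocE] for unit preservation.
    [tensor_assoc_bil] serves first for the multiplications, then for the representations. *)
Definition spec_assoc : spec_hom (spec_tensor (spec_tensor R S) T)
    (spec_tensor R (spec_tensor S T)) :=
  @SpecHom K (spec_tensor (spec_tensor R S) T) (spec_tensor R (spec_tensor S T))
    fa fs (@tensor_assocE K _ _ _ _ _ _) (tensor_assoc_bil _ _ _) spec_assoc_surj
    spec_assoc_dirac spec_assoc_grading (tensor_assoc_bil _ _ _).

Lemma spec_assoc_iso : @is_iso (Spec K) _ _ spec_assoc.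
Proof.
refine (@spec_iso _ _ spec_assoc
  (@tensor_assoc_inv K _ _ _) (@tensor_assoc_inv K _ _ _) _ _ _ _).
- exact: tensor_assocK.
- exact: tensor_assoc_invK.
- exact: tensor_assocK.
- exact: tensor_assoc_invK.
Qed.
End Associator.

Section Unitors.
Variable S : even_spectral_triple K.

Lemma spec_lunit_alg1 :
  @tensor_lunit K (st_alg S) (alg_one (st_alg (spec_tensor (spec_unit K) S))) =
  alg_one (st_alg S).
Proof. by rewrite tensor_lunitE scale1r. Qed.

Lemma spec_lunit_surj w : exists v, @tensor_lunit K (st_space S) v = w.
Proof. by exists (tensor_lunit_inv w); exact: tensor_lunit_invK. Qed.

Lemma spec_lunit_dirac v :
  @tensor_lunit K (st_space S) (st_dirac (spec_tensor (spec_unit K) S) v) =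
  st_dirac S (@tensor_lunit K (st_space S) v).
Proof.
rewrite /= linearD /= tensor_lunit_natural.
(* Naturality has treated the summand with the Dirac operator of [S]; the other one has the zero
   operator as a tensor factor. *)
rewrite (_ : tensor_map _ _ v = 0) ?linear0 ?add0r//.
elim/tensor_ind: v => [|k v|x y xE yE]; first by rewrite linear0.
  by rewrite tensor_mapE /= linear0l.
by rewrite linearD /= xE yE addr0.
Qed.

(** Compatibility with the gradings is naturality of the unitor at the grading of [S], the unit
    object having grading [idfun]. *)
Definition spec_lunit : spec_hom (spec_tensor (spec_unit K) S) S :=
  @SpecHom K (spec_tensor (spec_unit K) S) S
    (@tensor_lunit K (st_alg S)) (@tensor_lunit K (st_space S))
    spec_lunit_alg1 (tensor_lunit_bil _) spec_lunit_surj
    spec_lunit_dirac (tensor_lunit_natural _) (tensor_lunit_bil _).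

Lemma spec_lunit_iso : @is_iso (Spec K) _ _ spec_lunit.
Proof.
refine (@spec_iso _ _ spec_lunit (@tensor_lunit_inv K _) (@tensor_lunit_inv K _) _ _ _ _).
- exact: tensor_lunitK.
- exact: tensor_lunit_invK.
- exact: tensor_lunitK.
- exact: tensor_lunit_invK.
Qed.

Lemma spec_runit_alg1 :
  @tensor_runit K (st_alg S) (alg_one (st_alg (spec_tensor S (spec_unit K)))) =
  alg_one (st_alg S).
Proof. by rewrite tensor_runitE scale1r. Qed.

Lemma spec_runit_surj w : exists v, @tensor_runit K (st_space S) v = w.
Proof. by exists (tensor_runit_inv w); exact: tensor_runit_invK. Qed.

Lemma spec_runit_dirac v :
  @tensor_runit K (st_space S) (st_dirac (spec_tensor S (spec_unit K)) v) =
  st_dirac S (@tensor_runit K (st_space S) v).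
Proof.
rewrite /= linearD /= tensor_runit_natural.
(* On this side the vanishing summand is the grading of [S] tensored with the zero Dirac
   operator. *)
rewrite (_ : tensor_map (st_grading S) _ v = 0) ?linear0 ?addr0//.
elim/tensor_ind: v => [|v k|x y xE yE]; first by rewrite linear0.
  by rewrite tensor_mapE /= linear0r.
by rewrite linearD /= xE yE addr0.
Qed.

Definition spec_runit : spec_hom (spec_tensor S (spec_unit K)) S :=
  @SpecHom K (spec_tensor S (spec_unit K)) S
    (@tensor_runit K (st_alg S)) (@tensor_runit K (st_space S))
    spec_runit_alg1 (tensor_runit_bil _) spec_runit_surj
    spec_runit_dirac (tensor_runit_natural _) (tensor_runit_bil _).

Lemma spec_runit_iso : @is_iso (Spec K) _ _ spec_runit.
Proof.
refine (@spec_iso _ _ spec_runit (@tensor_runit_inv K _) (@tensor_runit_inv K _) _ _ _ _).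
- exact: tensor_runitK.
- exact: tensor_runit_invK.
- exact: tensor_runitK.
- exact: tensor_runit_invK.
Qed.
End Unitors.

End SpecMonoidal.

Theorem proposition2p6 (K : fieldType) :
  inhabited (@monoidal_structure (Spec K) (@spec_tensor K)
    (@spec_tensor_hom K) (spec_unit K)).
Proof.
split; apply: (@MonoidalStructure (Spec K) _ _ _ _ _
  (@spec_assoc K) (@spec_lunit K) (@spec_runit K)).
(* Each equation of morphisms splits by [spec_hom_eq] into one on algebras and one on spaces, both
   settled by the same identity of linear maps. *)
- by move=> S T; apply: spec_hom_eq; exact: tensor_map_id.
- by move=> *; apply: spec_hom_eq; exact: tensor_map_comp.
- exact: spec_assoc_iso.
- exact: spec_lunit_iso.
- exact: spec_runit_iso.
- by move=> *; apply: spec_hom_eq; exact: tensor_assoc_natural.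
- by move=> *; apply: spec_hom_eq; exact: tensor_lunit_natural.
- by move=> *; apply: spec_hom_eq; exact: tensor_runit_natural.
- by move=> *; apply: spec_hom_eq; exact: tensor_pentagon.
- by move=> *; apply: spec_hom_eq; exact: tensor_triangle.
Qed.
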